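(* Let $G$ be a finite simple undirected graph with $|V(G)|\ge 5$. Then there is a set $D\subseteq V(G)$ with $|D|\le 3$ such that the induced subgraph $G-D=G[V(G)\setminus D]$ contains at least three vertices that have the same degree in $G-D$. Consequently, $C(3)=3$.
   Context: All graphs are finite, simple and undirected. For a graph $H$ with at least one vertex, the repetition number $\mathrm{rep}(H)$ is the maximum number of vertices of $H$ that share a common degree. For a positive integer $k$, $C(k)$ denotes the least integer such that every graph $G$ on $n$ vertices has an induced subgraph with at least $n-C(k)$ vertices whose repetition number is at least $\min\{k,\,n-C(k)\}$. *)

(* Defs.v *)
From HB Require Import structures.
From mathcomp Require Import all_boot all_order all_algebra.

Set Implicit Arguments.
Unset Strict Implicit.
Unset Printing Implicit Defensive.

Import Order.TTheory GRing.Theory Num.Theory.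

Record sgraph := SGraph {
  vertex :> finType;
  edge : rel vertex;
  edge_sym : symmetric edge;
  edge_irr : irreflexive edge }.

Section Induced.
Variables (G : sgraph) (S : {set G}).

Definition induced_edge : rel {x : G | x \in S} :=
  fun x y => edge (val x) (val y).

Lemma induced_edge_sym : symmetric induced_edge.
Proof. by move=> x y; rewrite /induced_edge edge_sym. Qed.

Lemma induced_edge_irr : irreflexive induced_edge.
Proof. by move=> x; rewrite /induced_edge edge_irr. Qed.

Definition induced : sgraph := SGraph induced_edge_sym induced_edge_irr.

End Induced.

Definition deg (H : sgraph) (v : H) : nat := #|[set w : H | edge v w]|.

Definition deg_class (H : sgraph) (d : nat) : {set H} :=
  [set v : H | deg v == d].

(* Only meaningful when H has a vertex; on the null graph it is 0. *)
Definition rep (H : sgraph) : nat := \max_(v : H) #|deg_class H (deg v)|.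

Local Open Scope ring_scope.

(* The constant c and the bound n - c range over int, so n - c is a genuine
   (possibly negative) difference.  As rep is only defined for graphs with a
   vertex, the null graph is excluded both for G and for its induced
   subgraph; admitting it for G would leave no admissible c at all. *)
Definition admissible (k : nat) (c : int) : Prop :=
  forall G : sgraph, (0 < #|G|)%N ->
  exists S : {set G},
    [/\ S != set0,
        #|G|%:Z - c <= #|S|%:Z &
        Num.min k%:Z (#|G|%:Z - c) <= (rep (induced S))%:Z].

(* is_C k c states that C(k) exists and equals c. *)
Definition is_C (k : nat) (c : int) : Prop :=
  admissible k c /\ (forall c' : int, admissible k c' -> c <= c').

(* Main.v *)
Require Import Defs.
From HB Require Import structures.
From mathcomp Require Import all_boot all_order all_algebra.
From mathcomp Require Import zify.
From Stdlib Require Import Classical_Prop.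

Set Implicit Arguments.
Unset Strict Implicit.
Unset Printing Implicit Defensive.

Import Order.TTheory GRing.Theory Num.Theory.

(** Suppose that no deletion of at most three vertices produces three equal
degrees.  An isolated or dominating vertex may be discarded by induction, so the
n vertices have degrees in 1..n-2, each taken at most twice: degrees taken
twice exceed omitted degrees by exactly two.  If a, b have degree d and c has
degree d+1, then c and one of a, b are twins up to the other one, since
otherwise one or two deletions equate a, b, c.  Extending such configurations
degree by degree (and using complementation, which preserves the hypothesis)
shows that the pattern of multiplicities contains no 2 1...1 2, no 2 followed by
four nonzero entries, and that each pair 2 2 is surrounded by two zeros on
either side (or reaches an end of the range), and that an initial 2 2 also
excludes degree 5.  Such patterns have an excess of at most one once n >= 5, a
contradiction. *)

(* The truncated subtractions are exact: [count (edge v) D <= deg v] when D has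
   no repetition. *)
Definition rep3 (m : nat) (G : sgraph) : Prop :=
  exists (x y z : G) (D : seq G),
    [/\ uniq [:: x, y, z & D], size D <= m,
        deg x - count (edge x) D = deg y - count (edge y) D &
        deg x - count (edge x) D = deg z - count (edge z) D].

(** * Neighbourhoods outside a list of vertices *)

Definition outside (G : sgraph) (L : seq G) (v : G) : {set G} :=
  [set w | edge v w & w \notin L].

Lemma deg_outside (G : sgraph) (L : seq G) (uL : uniq L) (v : G) :
  deg v = count (edge v) L + #|outside L v|.
Proof.
rewrite /deg -(cardsID [set w in L]); congr (_ + _).
  rewrite -size_filter -(card_uniqP (filter_uniq _ uL)) -cardsE.
  by apply: eq_card => w; rewrite !inE mem_filter.
by apply: eq_card => w; rewrite !inE andbC.
Qed.

Lemma in_outside (G : sgraph) (L : seq G) (v w : G) :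
  (w \in outside L v) = edge v w && (w \notin L).
Proof. by rewrite inE. Qed.

(** Both sides count the union, so a degree gap between [u] and [v] bounds one set difference from
    below. *)
Lemma card_outside_diff (G : sgraph) (L : seq G) (u v : G) :
  #|outside L u| + #|outside L v :\: outside L u| =
  #|outside L v| + #|outside L u :\: outside L v|.
Proof.
have := cardsID (outside L u) (outside L v); have := cardsID (outside L v) (outside L u).
by rewrite setIC; lia.
Qed.

Lemma outside_diff (G : sgraph) (L : seq G) (u v : G) (k : nat) :
  k <= #|outside L v :\: outside L u| ->
  exists s : seq G, [/\ uniq s, size s = k &
    forall w, w \in s -> [/\ edge v w = true, edge u w = false & w \notin L]].
Proof.
set R := _ :\: _ => leR; exists (take k (enum R)); split; first exact/take_uniq/enum_uniq.
  by rewrite size_takel // -cardE.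
move=> w /mem_take; rewrite mem_enum !inE => /andP[nuw /andP[-> wL]].
by split => //; move: nuw; rewrite wL andbT => /negbTE.
Qed.

Lemma outside_diff1 (G : sgraph) (L : seq G) (u v : G) :
  0 < #|outside L v :\: outside L u| ->
  exists w, [/\ edge v w = true, edge u w = false & w \notin L].
Proof.
case/outside_diff => s [us ss hs]; case: s us ss hs => [|w []] // _ _ hs; exists w.
by apply: hs; rewrite !inE eqxx.
Qed.

Lemma outside_diff2 (G : sgraph) (L : seq G) (u v : G) :
  1 < #|outside L v :\: outside L u| ->
  exists w1 w2, [/\ w1 <> w2, [/\ edge v w1 = true, edge u w1 = false & w1 \notin L]
    & [/\ edge v w2 = true, edge u w2 = false & w2 \notin L]].
Proof.
case/outside_diff => s [us ss hs]; case: s us ss hs => [|w1 [|w2 []]] // /andP[+ _] _ hs.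
rewrite inE => /eqP ne.
by exists w1, w2; split=> //; apply: hs; rewrite !inE eqxx ?orbT.
Qed.

Lemma outside_diff3 (G : sgraph) (L : seq G) (u v : G) :
  2 < #|outside L v :\: outside L u| ->
  exists w1 w2 w3, [/\ uniq [:: w1; w2; w3],
    [/\ edge v w1 = true, edge u w1 = false & w1 \notin L],
    [/\ edge v w2 = true, edge u w2 = false & w2 \notin L] &
    [/\ edge v w3 = true, edge u w3 = false & w3 \notin L]].
Proof.
case/outside_diff => s [us ss hs]; case: s us ss hs => [|w1 [|w2 [|w3 []]]] // us _ hs.
by exists w1, w2, w3; split=> //; apply: hs; rewrite !inE eqxx ?orbT.
Qed.

(** Serves to keep the exceptional vertex of a [p4_defect] out of the chosen witnesses, at the cost
    of one of them. *)
Lemma outside_diff_cons (G : sgraph) (L : seq G) (r u v : G) :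
  #|outside L v :\: outside L u| <= (#|outside (r :: L) v :\: outside (r :: L) u|).+1.
Proof.
have -> : outside (r :: L) v :\: outside (r :: L) u = (outside L v :\: outside L u) :\ r.
  apply/setP => w; rewrite !inE negb_or.
  by case: (w == r) (edge u w) (edge v w) (w \in L) => [] [] [] [].
by rewrite [X in X <= _](cardsD1 r); case: (r \in _).
Qed.

Lemma outside_sub_eq (G : sgraph) (L : seq G) (u v : G) :
  #|outside L u| <= #|outside L v| ->
  (forall w, w \notin L -> edge v w -> edge u w) ->
  #|outside L u| = #|outside L v| /\
  (forall w, w \notin L -> edge u w = edge v w).
Proof.
move=> le_uv sub_vu.
have sub : outside L v \subset outside L u.
  by apply/subsetP => w; rewrite !inE => /andP[vw wL]; rewrite wL sub_vu.
have /eqP eq_vu : outside L v == outside L u by rewrite eqEcard sub.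
split=> [|w wL]; first by rewrite eq_vu.
by have := congr1 (fun A : {set G} => w \in A) eq_vu; rewrite !inE wL !andbT.
Qed.


(** * Distinctness, adjacency and degree arithmetic *)

Lemma notin_cons (T : eqType) (w x : T) (s : seq T) :
  w <> x -> w \notin s -> w \notin x :: s.
Proof. by move=> /eqP wx ws; rewrite inE negb_or wx. Qed.

Lemma notin_consE (T : eqType) (w x : T) (s : seq T) :
  w \notin x :: s -> w <> x /\ w \notin s.
Proof. by rewrite inE negb_or => /andP[/eqP]. Qed.

Lemma uniq_cons (T : eqType) (x : T) (s : seq T) :
  x \notin s -> uniq s -> uniq (x :: s).
Proof. by move=> /= -> ->. Qed.

Ltac unpack := repeat match goal with
  | H : is_true (uniq (_ :: _)) |- _ => let H1 := fresh "nin" in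
      rewrite cons_uniq in H; case/andP: H => H1 H
  | H : is_true (uniq [::]) |- _ => clear H
  | H : is_true (_ \notin _ :: _) |- _ => let H1 := fresh "ne" in
      case/notin_consE: H => H1 H
  | H : is_true (_ \notin [::]) |- _ => clear H
  | H : is_true (edge ?u ?v) |- _ => change (edge u v = true) in H
  | H : is_true (~~ edge _ _) |- _ => move/negbTE: H => H
  end.

Ltac edges := rewrite ?edge_irr; repeat match goal with
  | |- context [edge ?u ?v] => match goal with
    | H : edge u v = _ |- _ => rewrite H
    | H : edge v u = _ |- _ => rewrite (edge_sym u v) H
    end
  end.

Lemma edge_neql (G : sgraph) (u v w : G) (b : bool) :
  edge u w = b -> edge v w = ~~ b -> u <> v.
Proof. by move=> + + E; rewrite E => ->; case: b. Qed.

Ltac neq := first [ assumption | apply: nesym; assumption |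
  match goal with |- ?u <> ?v => match goal with
    | H : edge u ?w = ?b |- _ => apply: (edge_neql (b := b) (w := w)); edges; reflexivity
    | H : edge ?w u = ?b |- _ => apply: (edge_neql (b := b) (w := w)); edges; reflexivity
  end end ].

Ltac distinct :=
  repeat match goal with
  | |- is_true (uniq [::]) => reflexivity
  | |- is_true (_ \notin [::]) => reflexivity
  | |- is_true (uniq (_ :: _)) => apply: uniq_cons
  | |- is_true (_ \notin _ :: _) => apply: notin_cons
  end; try neq.

Ltac solve_deg :=
  repeat match goal with
  | H : ?P |- _ => match type of P with Prop =>
      lazymatch P with deg _ = _ => fail | _ => clear H end end
  end; lia.

Ltac lia_noedge :=
  repeat match goal with H : edge _ _ = ?b |- _ => clear H end; lia.

Tactic Notation "delete" constr(D) "equates" constr(x) constr(y) constr(z) :=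
  exists x, y, z, D; split; [distinct | by [] | rewrite /=; edges; solve_deg ..].

(** * Near twins among vertices of consecutive degrees *)

Lemma deg_neq (G : sgraph) (u v : G) : deg u <> deg v -> u <> v.
Proof. by move=> ne E; rewrite E in ne. Qed.

Ltac degne := apply: deg_neq; solve_deg.

(* Apart from each other and b, the vertices c and a are twins. *)
Definition covers (G : sgraph) (c a b : G) : Prop :=
  [/\ edge c b = true, edge a b = false &
      forall w, w <> a -> w <> b -> w <> c -> edge c w = edge a w].

(** Inside the triple, [c] gains at most 1 on [a], so outside it [c] has at least as many
    neighbours. The inclusion then forces equality there, and [b] accounts for the whole degree
    gap. *)
Lemma covers_of_sub (G : sgraph) (a b c : G) (d : nat) :
  a <> b -> a <> c -> b <> c -> deg a = d -> deg c = d.+1 ->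
  (forall w, w \notin [:: a; b; c] -> edge c w -> edge a w) -> covers c a b.
Proof.
move=> ab ac bc da dc sub.
have uL : uniq [:: a; b; c] by distinct.
have := deg_outside uL a; have := deg_outside uL c.
rewrite da dc /= !edge_irr (edge_sym c a) => ec ea.
have le : #|outside [:: a; b; c] a| <= #|outside [:: a; b; c] c|.
  by move: (edge c b) (edge a b) ec ea => [] []; lia_noedge.
have [eq_card eqw] := outside_sub_eq le sub.
split; [by move: ec ea; case: (edge c b) (edge a b) => [] []; lia_noedge..|].
by move=> w wa wb wc; rewrite eqw //; distinct.
Qed.

Lemma near_twin (G : sgraph) (a b c : G) (d : nat) :
  ~ rep3 3 G -> a <> b -> deg a = d -> deg b = d -> deg c = d.+1 ->
  covers c a b \/ covers c b a.
Proof.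
move=> no3 ab da db dc.
have ac : a <> c by degne. have bc : b <> c by degne.
(* Without such a [u], any [w] adjacent to [c] but not to [a] misses [b] too, and deleting [w] alone
   brings [c] down to [d]. *)
have [/existsP[u /and4P[uL cu au bu]]|none] :=
  boolP [exists u, [&& u \notin [:: a; b; c], edge c u, ~~ edge a u & edge b u]]; last first.
  left; apply: (covers_of_sub ab ac bc da dc) => w wL cw.
  apply/negPn/negP => aw; case/existsP: none.
  case bw: (edge b w); first by exists w; rewrite wL cw aw bw.
  by case: no3; unpack; delete [:: w] equates a b c.
right; apply: (covers_of_sub _ bc ac db dc); [neq|] => w wL cw.
apply/negPn/negP => /negbTE bw; case: no3; unpack.
have uw : u <> w by neq.
case aw: (edge a w); last by delete [:: w] equates a b c.
(* [c] loses two neighbours, [a] only [w] and [b] only [u]: all three end at d - 1. *)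
by delete [:: u; w] equates a b c.
Qed.

(* The path a - x - c - b is a module of the graph with E removed. *)
Record p4_module (G : sgraph) (E : seq G) (a x c b : G) : Prop := P4Module {
  p4_ax : edge a x = true; p4_xc : edge x c = true; p4_cb : edge c b = true;
  p4_ac : edge a c = false; p4_ab : edge a b = false; p4_xb : edge x b = false;
  p4_out : forall w, w \notin [:: a, x, c, b & E] ->
    [/\ edge x w = edge a w, edge c w = edge a w & edge b w = edge a w] }.

(* The shape forced by degrees d, d, d+1, d+2: the path a - x - c - b would be a
   module, were it not for the vertex r, adjacent to x only. *)
Record p4_defect (G : sgraph) (d : nat) (a x c b r : G) : Prop := P4Defect {
  p4d_uniq : uniq [:: a; x; c; b; r];
  p4d_a : deg a = d; p4d_b : deg b = d; p4d_c : deg c = d.+1; p4d_x : deg x = d.+2;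
  p4d_mod : p4_module [:: r] a x c b;
  p4d_ar : edge a r = false; p4d_br : edge b r = false;
  p4d_cr : edge c r = false; p4d_xr : edge x r = true }.

(** * The pattern 2 1 1 1 1 *)

(** Degree counting on [L], played against an upper bound on [R], fixes the adjacencies among the
    four vertices and leaves a single vertex outside that tells them apart. *)
Lemma p4_of_covers (G : sgraph) (a b c x : G) (d : nat) :
  ~ rep3 3 G -> a <> b -> deg a = d -> deg b = d -> deg c = d.+1 -> deg x = d.+2 ->
  covers c a b -> exists r, p4_defect d a x c b r.
Proof.
move=> no3 ab da db dc dx [cb nab twin].
have ac : a <> c by degne. have bc : b <> c by degne.
have ax : a <> x by degne. have bx : b <> x by degne. have cx : c <> x by degne.
have eq_xc : edge x c = edge x a by rewrite edge_sym twin; [exact: edge_sym | neq..].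
set L := [:: a; x; c; b].
have uL : uniq L by rewrite /L; distinct.
have sa := deg_outside uL a; have sx := deg_outside uL x.
have sb := deg_outside uL b.
rewrite da /= edge_irr nab (edge_sym a x) in sa.
rewrite dx /= edge_irr eq_xc in sx.
rewrite db /= edge_irr (edge_sym b a) nab (edge_sym b c) cb in sb.
have := card_outside_diff L a x; set R := outside L x :\: _ => cardR.
(* Otherwise delete [b] and [2 - edge x b] vertices of [R]: [c] agrees with [a] on [R] and loses
   only [b], so [a], [c], [x] all get degree [d]. *)
have few : #|R| < 2 - edge x b.
  rewrite ltnNge; apply/negP => /outside_diff[s [us ss hs]].
  have cs w : w \in s -> edge c w = false.
    by case/hs => _ aw /[dup] + wL; rewrite /L => ?; unpack; rewrite twin //; neq.
  case: no3; case xb: (edge x b) ss => ss.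
    case: s us ss hs cs => [|w []] // _ _ hs cs.
    have [xw aw wL] := hs w (mem_head _ _); have cw := cs w (mem_head _ _).
    by rewrite /L in wL; unpack; delete [:: b; w] equates a c x.
  case: s us ss hs cs => [|w [|u []]] // us _ hs cs.
  have [xw aw wL] := hs w (mem_head _ _); have cw := cs w (mem_head _ _).
  have uin : u \in [:: w; u] by rewrite !inE eqxx orbT.
  have [xu au wuL] := hs u uin; have cu := cs u uin.
  by rewrite /L in wL wuL; unpack; delete [:: b; w; u] equates a c x.
(* If [x] missed [a] it would miss [c] too, and [R] would need at least [2 - edge x b] elements. *)
have xa : edge x a = true.
  by move: sa sx cardR few; case: (edge x a) (edge x b) => [] []; lia_noedge.
have nac : edge a c = false.
  by move: sa sx cardR few; rewrite xa; case: (edge a c) (edge x b) => [] []; lia_noedge.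
rewrite xa nac in sa sx eq_xc.
(* The bound on [R] is now attained, which leaves no room for a neighbour of [a] that [x] misses. *)
have sub_ax w : w \notin L -> edge a w -> edge x w.
  move=> wL aw; apply/negPn/negP => xw.
  have : 0 < #|outside L a :\: outside L x|.
    by apply/card_gt0P; exists w; rewrite in_setD !in_outside aw wL (negbTE xw).
  by move: sa sx cardR few; case: (edge x b); lia_noedge.
(* Otherwise deleting [a] and [w] leaves [b], [c] and [x] at degree [d]. *)
have sub_ab w : w \notin L -> edge a w -> edge b w.
  move=> wL aw; apply/negPn/negP => bw; have xw := sub_ax w wL aw.
  case: no3; rewrite /L in wL; unpack.
  have cw : edge c w = true by rewrite twin; neq.
  by delete [:: a; w] equates b c x.
have le_ab : #|outside L b| <= #|outside L a|.
  by move: sa sb; rewrite (edge_sym b x); case: (edge x b); lia_noedge.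
have [eq_card eq_ab] := outside_sub_eq le_ab sub_ab.
have xb : edge x b = false.
  by move: sa sb; rewrite (edge_sym b x); case: (edge x b); lia_noedge.
rewrite xb in sx few.
have /cards1P[r Rr] : #|R| == 1 by apply/eqP; lia_noedge.
have : r \in R by rewrite Rr set11.
rewrite in_setD !in_outside => /andP[+ /andP[xr rL]]; rewrite rL andbT => ar.
have br := eq_ab r rL; rewrite (negbTE ar) in br.
exists r; have uLr : uniq [:: a; x; c; b; r].
  by have := rcons_uniq [:: a; x; c; b] r; rewrite rL uL.
have cr : edge c r = false by rewrite twin; unpack; neq.
split=> //; first split=> //.
- by rewrite edge_sym.
- move=> w; rewrite -[[:: a, x, c, b & _]]/(rcons L r) mem_rcons inE negb_or.
  case/andP=> wr wL; rewrite eq_ab //; split=> //;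
    last by rewrite /L in wL; unpack; rewrite twin //; neq.
  apply/idP/idP => [xw|]; last exact: sub_ax.
  by apply/negPn/negP => aw; move/negP: wr; case;
    rewrite -in_set1 -Rr in_setD !in_outside (negbTE aw) wL xw.
- exact/negbTE.
Qed.

Lemma p4_of_degrees (G : sgraph) (a b c x : G) (d : nat) :
  ~ rep3 3 G -> a <> b -> deg a = d -> deg b = d -> deg c = d.+1 -> deg x = d.+2 ->
  exists a' b' r, p4_defect d a' x c b' r.
Proof.
move=> no3 ab da db dc dx; case: (near_twin no3 ab da db dc) => cov.
  by exists a, b; apply: p4_of_covers cov.
by exists b, a; apply: p4_of_covers cov => //; neq.
Qed.

Lemma p4d_out (G : sgraph) (d : nat) (a x c b r w : G) : p4_defect d a x c b r ->
  w <> a -> w <> x -> w <> c -> w <> b ->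
  edge c w = edge a w /\ edge b w = edge a w.
Proof.
case=> _ _ _ _ _ [_ _ _ _ _ _ out] ar br cr _ wa wx wc wb.
case: (eqVneq w r) => [->|/eqP wr]; first by rewrite ar br cr.
by have [] := out w ltac:(distinct).
Qed.

Lemma p4d_outx (G : sgraph) (d : nat) (a x c b r w : G) : p4_defect d a x c b r ->
  w <> a -> w <> x -> w <> c -> w <> b -> w <> r -> edge x w = edge a w.
Proof.
case=> _ _ _ _ _ [_ _ _ _ _ _ out] *.
by have [] := out w ltac:(distinct).
Qed.

(** If [y] missed [a] it would miss [b] and [c] as well, and deleting three neighbours it does not
    share with [a] would bring it to degree [d]. So it sees the whole path, and its surplus over [a]
    can only be [r]. *)
Lemma p4_defect_next (G : sgraph) (d : nat) (a x c b r y : G) :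
  ~ rep3 3 G -> p4_defect d a x c b r -> deg y = d + 3 ->
  [/\ edge a y = true, edge y r = true &
      forall w, w \notin [:: a; x; c; b; r; y] -> edge y w = edge a w].
Proof.
move=> no3 def dy; have out := p4d_out def; have outx := p4d_outx def.
case: def => u5 da db dc dx [ax xc cb ac ab xb _] ar br cr xr; unpack.
have ya : y <> a by degne. have yx : y <> x by degne.
have yc : y <> c by degne. have yb : y <> b by degne.
set L := [:: a; x; c; b; y].
have uL : uniq L by rewrite /L; distinct.
have := card_outside_diff L a y; set R := outside L y :\: _ => cardR.
have [cy byy] := out y ya yx yc yb.
have := deg_outside uL a; rewrite /=; edges; rewrite da => sa.
have := deg_outside uL y; rewrite /=; edges; rewrite dy => sy.
have ay : edge a y = true.
  apply/negPn/negP => /negbTE ay; case: no3.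
  rewrite ay in cy byy sa; rewrite !(edge_sym y) ay ?cy ?byy in sy.
  have /outside_diff3[w1 [w2 [w3 [uw [yw1 aw1 w1L] [yw2 aw2 w2L] [yw3 aw3 w3L]]]]] : 2 < #|R|.
    by move: sy; case: (edge x y); lia_noedge.
  rewrite /L in w1L w2L w3L; unpack.
  have [_ bw1] := out w1 ltac:(neq) ltac:(neq) ltac:(neq) ltac:(neq).
  have [_ bw2] := out w2 ltac:(neq) ltac:(neq) ltac:(neq) ltac:(neq).
  have [_ bw3] := out w3 ltac:(neq) ltac:(neq) ltac:(neq) ltac:(neq).
  by delete [:: w1; w2; w3] equates a b y.
have yr : y <> r by neq.
have xy := outx y ya yx yc yb yr.
rewrite ay in cy byy sa xy; rewrite !(edge_sym y) ay ?cy ?byy ?xy ?ay in sy.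
(* Another surplus vertex [w], deleted along with [a], would put [c], [x] and [y] at d + 1. *)
have Rr w : w \in R -> w = r.
  rewrite in_setD !in_outside => /andP[+ /andP[yw wL]]; rewrite wL andbT => aw.
  apply/eqP/negPn/negP => /eqP wr; case: no3; rewrite /L in wL; unpack.
  have [cw _] := out w ltac:(neq) ltac:(neq) ltac:(neq) ltac:(neq).
  have xw := outx w ltac:(neq) ltac:(neq) ltac:(neq) ltac:(neq) ltac:(neq).
  by delete [:: a; w] equates c x y.
have /card_gt0P[r' r'R] : 0 < #|R| by lia_noedge.
have rR : r \in R by rewrite -(Rr r').
have le1 : #|R| <= 1.
  by rewrite -(cards1 r); apply/subset_leq_card/subsetP => w /Rr ->; rewrite set11.
have noL : outside L a :\: outside L y = set0.
  by apply/eqP; rewrite -cards_eq0; apply/eqP; lia_noedge.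
split=> //; first by move: rR; rewrite in_setD !in_outside => /andP[_ /andP[]].
move=> w wL'; have wL : w \notin L by rewrite /L; unpack; distinct.
have wr : w <> r by unpack.
have := in_set0 w; rewrite -noL in_setD !in_outside wL !andbT.
have : w \notin R by apply/negP => /Rr.
rewrite in_setD !in_outside wL !andbT.
by case: (edge a w) (edge y w) => [] [].
Qed.

(** [x] and [y] both see [r] and otherwise agree with [a] outside the path. Deleting [b], which
    lowers [y] but not [x], and suitable neighbours of [z] brings [x], [y], [z] to d + 2. *)
Lemma no_2_1_1_1_1 (G : sgraph) (a b c x y z : G) (d : nat) :
  ~ rep3 3 G -> a <> b -> deg a = d -> deg b = d ->
  deg c = d.+1 -> deg x = d.+2 -> deg y = d + 3 -> deg z = d + 4 -> False.
Proof.
move=> no3 ab0 da0 db0 dc0 dx0 dy dz; apply: (no3).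
have [a' [b' [r def]]] := p4_of_degrees no3 ab0 da0 db0 dc0 dx0.
move: a' b' def => {ab0 da0 db0} {}a {}b def.
have out := p4d_out def; have outx := p4d_outx def.
have [ay yr outy] := p4_defect_next no3 def dy.
case: def => u5 da db dc dx [ax xc cb ac ab xb _] ar br cr xr; unpack.
have ya : y <> a by degne. have yx : y <> x by degne.
have yc : y <> c by degne. have yb : y <> b by degne.
have za : z <> a by degne. have zx : z <> x by degne. have zy : z <> y by degne.
have zc : z <> c by degne. have zb : z <> b by degne.
have ner : y <> r by neq.
have [cy byy] := out y ya yx yc yb; rewrite ay in cy byy.
have xy := outx y ya yx yc yb ner; rewrite ay in xy.
have [cz bz] := out z za zx zc zb.
set L := [:: a; x; c; b; y; z].
have uL : uniq L by rewrite /L; distinct.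
have cardR := card_outside_diff L a z; have leR := outside_diff_cons L r a z.
have := deg_outside uL a; rewrite /=; edges; rewrite da => sa.
have := deg_outside uL z; rewrite /= !(edge_sym z); edges; rewrite dz => sz.
(* If [z] is adjacent to [a] it also loses [b], so one further deletion suffices; otherwise two are
   made. *)
case az: (edge a z); rewrite az in cz bz sa sz.
  have zr : z <> r by neq.
  have xz := outx z za zx zc zb zr; rewrite az in xz.
  have yz : edge y z = true by rewrite outy //; distinct.
  rewrite xz yz in sz.
  have /outside_diff1[w [zw aw wL]] :
    0 < #|outside (r :: L) z :\: outside (r :: L) a| by lia_noedge.
  rewrite /L in wL; unpack.
  have xw := outx w ltac:(neq) ltac:(neq) ltac:(neq) ltac:(neq) ltac:(neq).
  have yw : edge y w = false by rewrite outy //; distinct.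
  by delete [:: b; w] equates x y z.
have /outside_diff2[w1 [w2 [ne12 [zw1 aw1 w1L] [zw2 aw2 w2L]]]] :
    1 < #|outside (r :: L) z :\: outside (r :: L) a|.
  by move: sz; case: (edge x z) (edge y z) => [] []; lia_noedge.
rewrite /L in w1L w2L; unpack.
have xw1 := outx w1 ltac:(neq) ltac:(neq) ltac:(neq) ltac:(neq) ltac:(neq).
have xw2 := outx w2 ltac:(neq) ltac:(neq) ltac:(neq) ltac:(neq) ltac:(neq).
have yw1 : edge y w1 = false by rewrite outy //; distinct.
have yw2 : edge y w2 = false by rewrite outy //; distinct.
by delete [:: b; w1; w2] equates x y z.
Qed.

(** * Complementation *)

Section Complement.
Variable G : sgraph.

Definition compl_edge : rel G := fun u v => (u != v) && ~~ edge u v.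

Lemma compl_edge_sym : symmetric compl_edge.
Proof. by move=> u v; rewrite /compl_edge eq_sym edge_sym. Qed.

Lemma compl_edge_irr : irreflexive compl_edge.
Proof. by move=> u; rewrite /compl_edge eqxx. Qed.

Definition compl : sgraph := SGraph compl_edge_sym compl_edge_irr.

Lemma deg_compl (v : G) : deg v + @deg compl v = #|G|.-1.
Proof.
rewrite /deg -(cardsC1 v) -(cardsID [set w | edge v w] [set~ v]).
congr (_ + _); apply: eq_card => w; rewrite !inE /= ?/compl_edge.
  by case: eqP => [->|]; rewrite ?edge_irr.
by rewrite andbC eq_sym.
Qed.

(** After the deletion, the degrees of a remaining vertex in the two graphs have a constant sum, so
    equal degrees stay equal. *)
Lemma rep3_compl (m : nat) : rep3 m compl -> rep3 m G.
Proof.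
case=> x [y [z [D [uL szD eqxy eqxz]]]]; exists x, y, z, D.
have cnt (E : seq G) (v : G) : v \notin E ->
    count (edge v) E + count (@edge compl v) E = size E.
  elim: E => //= w E IH; rewrite inE negb_or => /andP[vw /IH <-].
  by rewrite addnACA /compl_edge vw; case: (edge v w).
have uD : uniq D by case/and4P: uL.
have le (H : sgraph) (E : seq H) v : uniq E -> count (edge v) E <= deg v.
  by move=> uE; rewrite (deg_outside uE) leq_addr.
have [xD yD zD] : [/\ x \notin D, y \notin D & z \notin D].
  by move: uL; rewrite /= !inE !negb_or => /and4P[/and3P[_ _ ->] /andP[_ ->] ->].
have := (deg_compl x, deg_compl y, deg_compl z, cnt D x xD, cnt D y yD, cnt D z zD).
have := (le G D x uD, le G D y uD, le G D z uD).
have := (le compl D x uD, le compl D y uD, le compl D z uD).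
move=> [[? ?] ?] [[? ?] ?] [[[[[? ?] ?] ?] ?] ?].
by split=> //; clear cnt le uL; lia.
Qed.

End Complement.

Lemma deg_compl_eq (G : sgraph) (v : G) (d e : nat) :
  deg v = d -> d + e = #|G|.-1 -> deg (v : compl G) = e.
Proof. by move=> <- /eqP; rewrite -(deg_compl v) eqn_add2l => /eqP. Qed.

Lemma deg_le (G : sgraph) (v : G) : deg v <= #|G|.-1.
Proof. by rewrite -(deg_compl v) leq_addr. Qed.

(** In the complement the pair has the lower degree, so [near_twin] applies; [covers a x y] there
    means [covers x a y] in [G]. *)
Lemma near_twin_compl (G : sgraph) (a x y : G) (d : nat) :
  ~ rep3 3 G -> x <> y -> deg a = d -> deg x = d.+1 -> deg y = d.+1 ->
  covers x a y \/ covers y a x.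
Proof.
move=> no3 xy da dx dy; have := deg_le x; rewrite dx => le.
have eqd : d.+1 + (#|G|.-1 - d.+1) = #|G|.-1 by lia.
have da' : @deg (compl G) a = (#|G|.-1 - d.+1).+1 by apply: (deg_compl_eq da); lia.
have ax : a <> x by degne. have ay : a <> y by degne.
have conv (u v : G) : u <> v -> a <> u -> a <> v -> @covers (compl G) a u v -> covers u a v.
  move=> uv au av [/= + + tw]; rewrite /compl_edge.
  have [/eqP/negbTE -> /eqP/negbTE ->] := (uv, av) => /= /negbTE nav /negbFE uve.
  split=> // w wa wv wu; have := tw w wu wv wa; rewrite /= /compl_edge.
  have [/eqP wa' /eqP wu'] := (wa, wu).
  by rewrite eq_sym wa' eq_sym wu' /=; case: (edge a w) (edge u w) => [] [].
case: (@near_twin (compl G) x y a _ (fun h => no3 (rep3_compl h)) xy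
  (deg_compl_eq dx eqd) (deg_compl_eq dy eqd) da') => cov; [left|right]; apply: conv => //; neq.
Qed.

(** * The patterns 2 1 2 and 2 1 1 2 *)

Lemma no_2_1_2 (G : sgraph) (a b c x y : G) (d : nat) :
  ~ rep3 3 G -> a <> b -> x <> y -> deg a = d -> deg b = d -> deg c = d.+1 ->
  deg x = d.+2 -> deg y = d.+2 -> False.
Proof.
move=> no3 ab xy da db dc dx dy; apply: (no3).
wlog cov : a b ab da db / covers c a b.
  move=> wl; case: (near_twin no3 ab da db dc); first exact: wl.
  by apply: wl => //; neq.
wlog cov' : x y xy dx dy / covers x c y.
  move=> wl; case: (near_twin_compl no3 xy dc dx dy); first exact: wl.
  by apply: wl => //; neq.
case: cov cov' => cb nab twa [xye ncy twc].
have ac : a <> c by degne. have bc : b <> c by degne.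
have ax : a <> x by degne. have bx : b <> x by degne.
have ay : a <> y by degne. have byy : b <> y by degne.
have cx : c <> x by degne. have cy : c <> y by degne.
(* Through the two twin relations [a] misses [y] like [c], and [x] sees [b] like [c]. Deleting [b]
   and [y] thus costs [a], [c], [x] exactly 0, 1, 2. *)
have nay : edge a y = false by rewrite -twa //; neq.
have xb : edge x b = true by rewrite twc //; neq.
by delete [:: b; y] equates a c x.
Qed.

Lemma edge_of_2_1_1 (G : sgraph) (a b c x : G) (d : nat) :
  ~ rep3 3 G -> a <> b -> deg a = d -> deg b = d -> deg c = d.+1 -> deg x = d.+2 ->
  edge c x = true.
Proof.
move=> no3 ab da db dc dx.
have [a' [b' [r []]]] := p4_of_degrees no3 ab da db dc dx.
by move=> _ _ _ _ _ [_ xc _ _ _ _ _] _ _ _ _; rewrite edge_sym.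
Qed.

(** The complementary form of [edge_of_2_1_1]; the two clash on the middle vertices of a pattern 2 1
    1 2. *)
Lemma nonedge_of_1_1_2 (G : sgraph) (c x y z : G) (d : nat) :
  ~ rep3 3 G -> y <> z -> deg y = d.+2 -> deg z = d.+2 -> deg x = d.+1 -> deg c = d ->
  edge c x = false.
Proof.
move=> no3 yz dy dz dx dc; have := deg_le y; rewrite dy => le.
set e := #|G|.-1 - d.+2; have eqd : d.+2 + e = #|G|.-1 by rewrite /e; lia.
have dx' : @deg (compl G) x = e.+1 by apply: (deg_compl_eq dx); lia.
have dc' : @deg (compl G) c = e.+2 by apply: (deg_compl_eq dc); lia.
have := @edge_of_2_1_1 (compl G) y z x c e (fun h => no3 (rep3_compl h)) yz
  (deg_compl_eq dy eqd) (deg_compl_eq dz eqd) dx' dc'.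
by rewrite /= /compl_edge edge_sym => /andP[_ /negbTE].
Qed.

Lemma no_2_1_1_2 (G : sgraph) (a b c x y z : G) (d : nat) :
  ~ rep3 3 G -> a <> b -> y <> z -> deg a = d -> deg b = d -> deg c = d.+1 ->
  deg x = d.+2 -> deg y = d.+3 -> deg z = d.+3 -> False.
Proof.
move=> no3 ab yz da db dc dx dy dz.
have := edge_of_2_1_1 no3 ab da db dc dx.
by rewrite (nonedge_of_1_1_2 no3 yz dy dz dx dc).
Qed.

(** * The pattern 2 2 and the gaps around it *)

(** Only one choice of near twins is consistent: from below, [c] with [a] and [x] with [b]; from
    above, [x] with [a] and [c] with [b]. Chained together, they make all four agree outside. *)
Lemma p4_of_2_2 (G : sgraph) (a b c x : G) (d : nat) :
  ~ rep3 3 G -> a <> b -> c <> x -> deg a = d -> deg b = d -> deg c = d.+1 ->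
  deg x = d.+1 -> covers c a b -> p4_module [::] a x c b.
Proof.
move=> no3 ab cx da db dc dx [cb nab twc].
have ac : a <> c by degne. have bc : b <> c by degne.
have ax : a <> x by degne. have bx : b <> x by degne.
have xcac : edge x c = edge a x by rewrite edge_sym twc //; neq.
case: (near_twin no3 ab da db dx) => -[xa' ab' twx].
  have xcac' : edge x c = edge a c by rewrite twx //; neq.
  by case: (near_twin_compl no3 cx da dc dx) => -[]; edges; congruence.
have xc : edge x c = true by rewrite twx 1?edge_sym //; neq.
case: (near_twin_compl no3 cx da dc dx) => -[_ + twa]; edges; first congruence.
move=> nac; case: (near_twin_compl no3 cx db dc dx) => -[_ + twb]; edges; last congruence.
move=> nbx; split=> //; edges => //.
move=> w wL; unpack.
have xw : edge x w = edge a w by rewrite twa //; neq.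
have cw : edge c w = edge a w by rewrite twc //; neq.
by rewrite xw cw -twb // cw.
Qed.

Lemma gap_after_2_2 (G : sgraph) (a b c x y : G) (d : nat) :
  ~ rep3 3 G -> a <> b -> c <> x -> deg a = d -> deg b = d -> deg c = d.+1 ->
  deg x = d.+1 -> [/\ deg y <> d.+2, deg y <> d.+3 & d = 1 -> deg y <> 5].
Proof.
move=> no3 ab cx da db dc dx.
wlog cov : a b ab da db / covers c a b.
  move=> wl; case: (near_twin no3 ab da db dc); first exact: wl.
  by apply: wl => //; neq.
have [ax xc cb nac _ nbx out] := p4_of_2_2 no3 ab cx da db dc dx cov.
case: cov => _ nab _.
have ac : a <> c by degne. have bc : b <> c by degne.
have nax : a <> x by degne. have nebx : b <> x by degne.
have far : deg y = d.+3 \/ deg y = d.+4 /\ d = 1 -> False.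
  move=> dy; apply: (no3).
  have ya : y <> a by apply: deg_neq; lia. have yx : y <> x by apply: deg_neq; lia.
  have yc : y <> c by apply: deg_neq; lia. have yb : y <> b by apply: deg_neq; lia.
  set L := [:: a; x; c; b; y].
  have uL : uniq L by rewrite /L; distinct.
  have cardR := card_outside_diff L a y.
  have [xy cy byy] := out y ltac:(distinct).
  have := deg_outside uL a; rewrite /=; edges; rewrite da => sa.
  have := deg_outside uL y; rewrite /= !(edge_sym y); edges => sy.
  (* [y] sees all of the path or none of it. In the first case [a] has two neighbours, which rules
     out [d = 1], and deleting [a], [b] and a surplus vertex gives degree [d]. In the second, two or
     three surplus vertices bring [y] to d + 1. *)
  case ay: (edge a y); rewrite ay in xy cy byy sa sy.
    case: dy => [dy|[_ d1]]; last by lia_noedge.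
    have /outside_diff1[w [yw aw wL]] : 0 < #|outside L y :\: outside L a|.
      by rewrite dy in sy; lia_noedge.
    rewrite /L in wL; unpack; have [xw cw bw] := out w ltac:(distinct).
    by delete [:: a; b; w] equates x c y.
  case: dy => [dy|[dy d1]]; rewrite dy in sy.
    have /outside_diff2[w1 [w2 [ne12 [yw1 aw1 w1L] [yw2 aw2 w2L]]]] :
      1 < #|outside L y :\: outside L a| by lia_noedge.
    rewrite /L in w1L w2L; unpack.
    have [xw1 cw1 _] := out w1 ltac:(distinct).
    have [xw2 cw2 _] := out w2 ltac:(distinct).
    by delete [:: w1; w2] equates x c y.
  have /outside_diff3[w1 [w2 [w3 [uw [yw1 aw1 w1L] [yw2 aw2 w2L] [yw3 aw3 w3L]]]]] :
    2 < #|outside L y :\: outside L a| by lia_noedge.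
  rewrite /L in w1L w2L w3L; unpack.
  have [xw1 cw1 _] := out w1 ltac:(distinct).
  have [xw2 cw2 _] := out w2 ltac:(distinct).
  have [xw3 cw3 _] := out w3 ltac:(distinct).
  by delete [:: w1; w2; w3] equates x c y.
split=> [dy|dy|d1 dy]; [|by apply: far; left|by apply: far; right; lia].
(* [near_twin] would make [c] and [x] nonadjacent, but they are joined in the path. *)
by case: (near_twin no3 cx dc dx dy) => -[_ + _]; edges.
Qed.

(** Complementation reverses the order of the degrees and exchanges the two pairs. *)
Lemma gap_before_2_2 (G : sgraph) (a b c x y : G) (d : nat) :
  ~ rep3 3 G -> a <> b -> c <> x -> deg a = d -> deg b = d -> deg c = d.+1 ->
  deg x = d.+1 -> (deg y).+1 <> d /\ (deg y).+2 <> d.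
Proof.
move=> no3 ab cx da db dc dx; have := deg_le c; rewrite dc => le.
set e := #|G|.-1 - d.+1; have eqd : d.+1 + e = #|G|.-1 by rewrite /e; lia.
have eqd' : d + e.+1 = #|G|.-1 by lia.
have [ne2 ne3 _] := @gap_after_2_2 (compl G) c x a b y e (fun h => no3 (rep3_compl h))
  cx ab (deg_compl_eq dc eqd) (deg_compl_eq dx eqd) (deg_compl_eq da eqd')
  (deg_compl_eq db eqd').
have := deg_compl y; split=> dy; [apply: ne2|apply: ne3]; lia.
Qed.

(** * Bounding the sum of the multiplicities *)

(** Induction on partial sums. Apart from the effect of an initial 2 2, [t i] can exceed [i] only
    within three steps of a 2 with positive entries since. There a further 2 is forbidden unless it
    follows directly, and then preceding zeros pay for it. *)
Lemma sum_multiplicities (m : nat -> nat) :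
  m 0 = 0 -> (forall d, m d <= 2) ->
  (forall d, m d = 2 -> 0 < m d.+1 -> m d.+2 = 2 -> False) ->
  (forall d, m d = 2 -> 0 < m d.+1 -> 0 < m d.+2 -> m d.+3 = 2 -> False) ->
  (forall d, m d = 2 -> 0 < m d.+1 -> 0 < m d.+2 -> 0 < m d.+3 -> m d.+4 = 0) ->
  (forall d, m d = 2 -> m d.+1 = 2 -> [/\ m d.+2 = 0, m d.+3 = 0 & d = 1 -> m 5 = 0]) ->
  (forall d, m d.+1 = 2 -> m d.+2 = 2 -> m d = 0) ->
  (forall d, m d.+2 = 2 -> m d.+3 = 2 -> m d = 0) ->
  forall i, 3 <= i -> \sum_(j < i.+1) m j <= i.+1.
Proof.
move=> m0 le2 no3 no4 no5 after before1 before2.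
pose t i := \sum_(j < i.+1) m j.
have t0 : t 0 = 0 by rewrite /t big_ord_recl big_ord0 m0.
have tS i : t i.+1 = t i + m i.+1 by rewrite /t big_ord_recr.
(* [run i]: position i lies at most three steps after a 2, with no 0 in between. *)
pose run i := exists j k, [/\ i = j + k, k <= 3, m j = 2 &
  forall l, 0 < l -> l <= k -> 0 < m (j + l)].
(* An initial 2 2 gives [t 2 = 4], the one exception to [t i <= i.+1]; its trace at [i = 3] is the
   extra alternative. *)
pose inv i := (t i <= i.+1 \/ i = 2 /\ m 1 = 2 /\ m 2 = 2) /\
  (t i <= i \/ (i = 3 /\ m 1 = 2 /\ m 2 = 2) \/ run i).
suff H i : inv i.
  move=> i i3; have [[//|[i2 _]] _] := H i; lia.
elim/ltn_ind: i => -[|i] IH.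
  by split; left; rewrite t0.
have [le_i shape] := IH i (ltnSn i).
have := le2 i.+1; case mi: (m i.+1) => [|[|[|//]]] _.
(* [m i.+1 = 0]: the sum stands still, which also absorbs the exception at 2. *)
- split; rewrite /inv tS mi addn0.
  + case: le_i => [|[i2 [m1 m2]]]; first by left; lia.
    by left; subst i; have := tS 1; have := tS 0; rewrite t0 m1 m2; lia.
  + case: le_i => [|[i2 [m1 m2]]]; first by left.
    by right; left; subst i.
(* [m i.+1 = 1]: a run grows by one step, unless it already spans three, where [no5] demands a 0. *)
- rewrite /inv tS mi; case: shape => [le|[[i3 [m1 m2]]|[j [k [ij k3 mj run_l]]]]].
  + by split; left; lia.
  + by have [_ m4 _] := after 1 m1 m2; subst i; rewrite m4 in mi.
  + have [k3'|k3'] := ltnP k 3.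
      have lei1 : t i <= i.+1.
        case: le_i => // -[i2 [m1 m2]]; have [m3 _ _] := after 1 m1 m2.
        by rewrite i2 m3 in mi.
      split; first by left; lia.
      right; right; exists j, k.+1; split=> //; first by lia.
      move=> l l0; rewrite leq_eqVlt => /orP[/eqP ->|]; last exact: run_l.
      by rewrite addnS -ij mi.
    have k_3 : k = 3 by lia.
    subst k; have := no5 j mj.
    have := run_l 1 isT isT; have := run_l 2 isT isT; have := run_l 3 isT isT.
    rewrite !addnS addn0 => p1 p2 p3 /(_ p3 p2 p1).
    by rewrite -[j.+4]/(j.+3.+1) (_ : j.+3 = i) ?mi //; lia.
(* [m i.+1 = 2]: a new run starts, and an old one can only have [k = 0]. *)
- have new_run : run i.+1.
    by exists i.+1, 0; split; rewrite ?addn0 // => l; case: l.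
  case: shape => [le|[[i3 [m1 m2]]|[j [k [ij k3 mj run_l]]]]].
  + by split; [left; rewrite tS mi; lia | right; right].
  + by have [_ m4 _] := after 1 m1 m2; subst i; rewrite m4 in mi.
  + case: k ij k3 run_l => [|[|[|[|//]]]]; rewrite ?addnS addn0 => ij _ run_l; subst i.
    * split; last by right; right.
      case: j mj mi IH {run_l new_run le_i} => [|[|[|j]]]; first by rewrite m0.
      - move=> m1 m2 _; by right.
      - move=> m2 m3 _; have m1 := before1 1 m2 m3; left.
        by rewrite !tS t0 m1 m2 m3.
      (* Two zeros precede the pair, so the bound carries over four steps from [j]. It fails at [j]
         only for an initial 2 2, and that forces [m 5 = 0]. *)
      - move=> mj mj1 IH; have mj' := before1 _ mj mj1; have mj'' := before2 _ mj mj1.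
        have [[le|[j2 [m1 m2]]] _] := IH j ltac:(lia).
          by left; rewrite !tS mj' mj'' mj mj1; lia.
        have [m3 m4 m5] := after 1 m1 m2; subst j.
        by rewrite m5 in mj.
    * have := run_l 1 isT isT; rewrite addn1 => p1.
      by case: (no3 j mj p1 mi).
    * have := run_l 1 isT isT; have := run_l 2 isT isT; rewrite addn1 addn2 => p2 p1.
      by case: (no4 j mj p1 p2 mi).
    * have := run_l 1 isT isT; have := run_l 2 isT isT; have := run_l 3 isT isT.
      rewrite addn1 addn2 addn3 => p3 p2 p1.
      by have := no5 j mj p1 p2 p3; rewrite mi.
Qed.

(** The multiplicities of the degrees 0, ..., n - 2 sum to n, whereas [sum_multiplicities] at
    [n - 2] bounds this sum by n - 1. *)
Lemma rep3_of_regular_range (G : sgraph) :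
  5 <= #|G| -> (forall v : G, 0 < deg v < #|G|.-1) -> rep3 3 G.
Proof.
move=> n5 range; apply: NNPP => no3.
pose m d := #|@deg_class G d|.
have m1 d : 0 < m d -> exists v : G, deg v = d.
  by case/card_gt0P => v; rewrite inE => /eqP; exists v.
have m2 d : m d = 2 -> exists u v : G, [/\ u <> v, deg u = d & deg v = d].
  move=> md; have /card_gt1P[u [v []]] : 1 < m d by rewrite md.
  by rewrite !inE => /eqP du /eqP dv /eqP uv; exists u, v.
have m0 d : (forall v : G, deg v <> d) -> m d = 0.
  move=> nod; apply/eqP; rewrite -leqn0 leqNgt; apply/negP => /m1[v dv].
  exact: nod dv.
have out d : ~~ (0 < d < #|G|.-1) -> m d = 0.
  by move=> nd; apply: m0 => v dv; rewrite -dv range in nd.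
have le2 d : m d <= 2.
  rewrite leqNgt; apply/negP => /card_gt2P[x [y [z [[]]]]].
  rewrite !inE => /eqP dx /eqP dy /eqP dz [xy yz zx]; case: no3.
  exists x, y, z, [::]; split=> //=; [|by rewrite dx dy|by rewrite dx dz].
  by rewrite !inE negb_or xy yz eq_sym zx.
have dlt (v : G) : deg v < #|G|.-1 by case/andP: (range v).
have total : \sum_(j < #|G|.-1) m j = #|G|.
  rewrite -[RHS]sum1_card (partition_big (fun v => Ordinal (dlt v)) predT) //=.
  by apply: eq_bigr => j _; rewrite /m -sum1_card; apply: eq_bigl => v; rewrite inE.
suff : \sum_(j < #|G|.-2.+1) m j <= #|G|.-2.+1.
  by rewrite (_ : #|G|.-2.+1 = #|G|.-1) ?total; lia.
apply: (sum_multiplicities (out 0 isT) le2); last by lia.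
- move=> d /m2[a [b [ab da db]]] /m1[c dc] /m2[x [y [xy dx dy]]].
  exact: (no_2_1_2 no3 ab xy da db dc dx dy).
- move=> d /m2[a [b [ab da db]]] /m1[c dc] /m1[x dx] /m2[y [z [yz dy dz]]].
  exact: (no_2_1_1_2 no3 ab yz da db dc dx dy dz).
- move=> d /m2[a [b [ab da db]]] /m1[c dc] /m1[x dx] /m1[y dy].
  have [//|/m1[z dz]] := posnP (m d.+4).
  by case: (@no_2_1_1_1_1 G a b c x y z d) => //; lia.
- move=> d /m2[a [b [ab da db]]] /m2[c [x [cx dc dx]]].
  have gap y := gap_after_2_2 y no3 ab cx da db dc dx.
  by split=> [||d1]; apply: m0 => y; have [] := gap y => // _ _ /(_ d1).
- move=> d /m2[a [b [ab da db]]] /m2[c [x [cx dc dx]]]; apply: m0 => y dy.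
  by have [] := gap_before_2_2 y no3 ab cx da db dc dx; rewrite dy.
- move=> d /m2[a [b [ab da db]]] /m2[c [x [cx dc dx]]]; apply: m0 => y dy.
  by have [] := gap_before_2_2 y no3 ab cx da db dc dx; rewrite dy.
Qed.

(** * Induction on the order *)

Lemma card_induced (G : sgraph) (S : {set G}) : #|induced S| = #|S|.
Proof. by rewrite card_sig; apply: eq_card => w; rewrite inE. Qed.

Lemma deg_induced (G : sgraph) (S : {set G}) (u : induced S) :
  deg u = #|[set w in S | edge (val u) w]|.
Proof.
rewrite /deg -(card_imset _ val_inj); apply: eq_card => w; rewrite !inE.
apply/imsetP/andP => [[t] | [wS uw]].
  by rewrite inE => ut ->; split; first exact: valP.
by exists (Sub w wS : induced S); rewrite ?inE.
Qed.

(** Removing [v] shifts all other degrees by the same amount [b]. *)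
Lemma rep3_remove (G : sgraph) (m : nat) (v : G) (b : bool) :
  (forall w, w != v -> edge v w = b) -> rep3 m (induced [set~ v]) -> rep3 m G.
Proof.
move=> hb [x [y [z [D [uL szD eqxy eqxz]]]]].
exists (val x), (val y), (val z), [seq val u | u <- D].
have degE (u : induced [set~ v]) : deg (val u) = deg u + b.
  have uv : val u != v by have := valP u; rewrite !inE.
  rewrite (@deg_outside _ [:: v]) // deg_induced /= addn0 addnC edge_sym hb //.
  by congr (_ + _); apply: eq_card => w; rewrite !inE andbC.
have cnt (u : induced [set~ v]) :
    count (edge (val u)) [seq val w | w <- D] = count (edge u) D.
  by rewrite count_map.
have le (u : induced [set~ v]) : uniq D -> count (edge u) D <= deg u.
  by move=> uD; rewrite (deg_outside uD) leq_addr.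
have uD : uniq D by case/and4P: uL.
split; first by rewrite -[X in uniq X]/(map val [:: x, y, z & D]) map_inj_uniq //; exact: val_inj.
- by rewrite size_map.
- by rewrite !degE !cnt; have := (le x uD, le y uD) => -[]; lia.
- by rewrite !degE !cnt; have := (le x uD, le z uD) => -[]; lia.
Qed.

Lemma rep3_of_homogeneous (G : sgraph) (x y z u w : G) (b : bool) :
  #|G| = 5 -> uniq [:: x; y; z; u; w] ->
  edge x y = b -> edge x z = b -> edge y z = b -> rep3 3 G.
Proof.
move=> n5 uL xy xz yz; exists x, y, z, [:: u; w].
have full : [:: x; y; z; u; w] =i G.
  by apply/subset_cardP; rewrite ?subset_predT // (card_uniqP uL) n5.
have degE v : deg v = count (edge v) [:: x; y; z; u; w].
  rewrite (deg_outside uL) -[RHS]addn0; congr (_ + _); apply: eq_card0 => t.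
  by rewrite in_outside full andbF.
by split=> //; rewrite !degE /=; edges; case: b {xy xz yz}; lia.
Qed.

(** The base case, where removing [v] would leave only four vertices. Either two of [p], [q], [r]
    form a homogeneous triple with [v], or [p], [q], [r] is one itself. *)
Lemma rep3_of_card5 (G : sgraph) (v : G) (b : bool) :
  #|G| = 5 -> (forall w, w != v -> edge v w = b) -> rep3 3 G.
Proof.
move=> n5 hb.
have : #|[set~ v]| = 4 by rewrite cardsC1 n5.
rewrite cardE; have := enum_uniq [set~ v]; have := mem_enum [set~ v].
case: (enum _) => [|p [|q [|r [|s [|//]]]]] //= memE uE _.
have hv w : w \in [:: p; q; r; s] -> edge v w = b by rewrite memE !inE => /hb.
have [vp vq vr vs] : [/\ edge v p = b, edge v q = b, edge v r = b & edge v s = b].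
  by split; apply: hv; rewrite !inE eqxx ?orbT.
have vE : v \notin [:: p; q; r; s] by rewrite memE !inE eqxx.
have uL : uniq [:: v; p; q; r; s] by rewrite cons_uniq vE.
have uL' (t : seq G) : perm_eq [:: v; p; q; r; s] t -> uniq t by move/perm_uniq <-.
have [pq|pq] := eqVneq (edge p q) b.
  exact: (rep3_of_homogeneous n5 uL vp vq pq).
have [pr|pr] := eqVneq (edge p r) b.
  by apply: (rep3_of_homogeneous n5 _ vp vr pr (u := q) (w := s)); unpack; distinct.
have [qr|qr] := eqVneq (edge q r) b.
  by apply: (rep3_of_homogeneous n5 _ vq vr qr (u := p) (w := s)); unpack; distinct.
apply: (@rep3_of_homogeneous G p q r v s (~~ b)) => //; first by unpack; distinct.
- by case: (edge p q) pq; case: (b).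
- by case: (edge p r) pr; case: (b).
- by case: (edge q r) qr; case: (b).
Qed.

Lemma rep3_3 (G : sgraph) : 5 <= #|G| -> rep3 3 G.
Proof.
have [n] := ubnP #|G|; elim: n => // n IH in G *; rewrite ltnS => leGn n5.
have [/existsP[v /existsP[b /forallP hb]]|reg] :=
    boolP [exists v : G, exists b : bool, forall w, (w != v) ==> (edge v w == b)].
  have hb' w : w != v -> edge v w = b by move=> wv; apply/eqP/(implyP (hb w)).
  have [n5'|n6] := leqP #|G| 5; first by apply: (rep3_of_card5 _ hb'); lia.
  have cardH : #|induced [set~ v]| = #|G|.-1 by rewrite card_induced cardsC1.
  by apply: (rep3_remove hb'); apply: IH; lia.
apply: rep3_of_regular_range => // v.
have neg (b : bool) : exists2 w, w != v & edge v w != b.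
  have : ~~ [forall w, (w != v) ==> (edge v w == b)].
    by apply: contra reg => hb; apply/existsP; exists v; apply/existsP; exists b.
  by rewrite negb_forall => /existsP[w]; rewrite negb_imply => /andP[]; exists w.
have [u uv /negPf vu] := neg true; have [w wv /negPf vw] := neg false.
rewrite /deg; apply/andP; split.
  by apply/card_gt0P; exists w; rewrite inE; case: (edge v w) vw.
rewrite -(cardsC1 v); apply/proper_card/properP; split.
  by apply/subsetP => t; rewrite !inE; apply: contraTneq => ->; rewrite edge_irr.
by exists u; rewrite !inE ?uv //; case: (edge v u) vu.
Qed.

(** * Deletion lists and induced subgraphs *)

Lemma rep3_set (m : nat) (G : sgraph) : rep3 m G ->
  exists D : {set G}, #|D| <= m /\ exists d, 3 <= #|deg_class (induced (~: D)) d|.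
Proof.
case=> x [y [z [D [uL szD eqxy eqxz]]]].
have uD : uniq D by case/and4P: uL.
exists [set w in D]; split; first by rewrite cardsE (card_uniqP uD).
exists (deg x - count (edge x) D); apply/card_gt2P.
have degE (u : induced (~: [set w in D])) : deg u = deg (val u) - count (edge (val u)) D.
  rewrite deg_induced (deg_outside uD) addKn.
  by apply: eq_card => w; rewrite !inE andbC.
have inS u : u \notin D -> u \in ~: [set w in D] by rewrite !inE.
move: uL; rewrite /= !inE !negb_or.
case/and4P => /and3P[xy xz /inS xD] /andP[yz /inS yD] /inS zD _.
exists (Sub x xD), (Sub y yD), (Sub z zD); split; last first.
  by split; rewrite -val_eqE //= eq_sym.
by split; rewrite inE degE /= ?eqxy ?eqxz //; apply/eqP; rewrite -?eqxy -?eqxz.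
Qed.

Lemma rep3_of_set (m : nat) (G : sgraph) (S : {set G}) (d : nat) :
  #|~: S| <= m -> 3 <= #|deg_class (induced S) d| -> rep3 m G.
Proof.
move=> leS /card_gt2P[x [y [z [[]]]]]; rewrite !inE => /eqP dx /eqP dy /eqP dz [xy yz zx].
exists (val x), (val y), (val z), (enum (~: S)).
have degE (u : induced S) : deg (val u) - count (edge (val u)) (enum (~: S)) = deg u.
  rewrite deg_induced (deg_outside (enum_uniq (~: S))) addKn.
  by apply: eq_card => w; rewrite !inE mem_enum inE negbK andbC.
split; rewrite ?degE ?dx ?dy ?dz -?cardE //.
by rewrite /= !inE !negb_or !mem_enum !inE !negbK !(valP x, valP y, valP z) !val_eqE xy yz
   (eq_sym x z) zx enum_uniq.
Qed.

Lemma rep_gt0 (G : sgraph) : 0 < #|G| -> 0 < rep G.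
Proof.
case/card_gt0P => v _; apply: leq_trans (leq_bigmax v).
by apply/card_gt0P; exists v; rewrite inE.
Qed.

Lemma deg_class_rep (G : sgraph) (d : nat) : #|@deg_class G d| <= rep G.
Proof.
have [->|/set0Pn[v]] := eqVneq (@deg_class G d) set0; first by rewrite cards0.
by rewrite inE => /eqP <-; apply: (leq_bigmax (F := fun v => #|deg_class G (deg v)|)).
Qed.

Lemma rep_deg_class (G : sgraph) (k : nat) :
  0 < k -> k <= rep G -> exists d, k <= #|@deg_class G d|.
Proof.
move=> k0 lek; apply: NNPP => none; have : rep G <= k.-1.
  apply/bigmax_leqP => v _; rewrite -ltnS prednK // ltnNge; apply/negP => le.
  by apply: none; exists (deg v).
by lia.
Qed.

(** * A graph in which two deletions do not suffice *)

Section Sharpness.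

(* Adjacency lists of an 8-vertex graph found by computer search. *)
Definition sharp_adj : seq (seq nat) :=
  [:: [:: 7]; [:: 2; 5; 7]; [:: 1; 5; 6; 7]; [:: 5; 6; 7]; [:: 5];
      [:: 1; 2; 3; 4; 6; 7]; [:: 2; 3; 5; 7]; [:: 0; 1; 2; 3; 5; 6]].

(** Defined on [nat] so that the checks over all small deletions reduce by computation. *)
Definition sharp_rel : rel nat := fun i j => j \in nth [::] sharp_adj i.

Definition sharp_edge : rel 'I_8 := fun i j => sharp_rel i j.

Lemma sharp_sym : symmetric sharp_edge.
Proof.
have /allP sym : all (fun i => all (fun j => sharp_rel i j == sharp_rel j i) (iota 0 8)) (iota 0 8).
  by [].
move=> i j; have /allP symi := sym i ltac:(by rewrite mem_iota ltn_ord).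
by apply/eqP/symi; rewrite mem_iota ltn_ord.
Qed.

Lemma sharp_irr : irreflexive sharp_edge.
Proof. by case=> -[|[|[|[|[|[|[|[|]]]]]]]]. Qed.

Definition sharp_graph : sgraph := SGraph sharp_sym sharp_irr.

Definition sharp_deg (D : seq nat) (i : nat) : nat :=
  count (sharp_rel i) (iota 0 8) - count (sharp_rel i) D.

Definition sharp_bad (D : seq nat) : bool :=
  let ds := [seq sharp_deg D i | i <- iota 0 8 & i \notin D] in
  has (fun d => 2 < count_mem d ds) ds.

Lemma sharp_bad_nil : ~~ sharp_bad [::].
Proof. by vm_compute. Qed.

Lemma sharp_bad1 : all (fun u => ~~ sharp_bad [:: u]) (iota 0 8).
Proof. by vm_compute. Qed.

Lemma sharp_bad2 :
  all (fun u => all (fun v => (u != v) ==> ~~ sharp_bad [:: u; v]) (iota 0 8)) (iota 0 8).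
Proof. by vm_compute. Qed.

Lemma not_rep3_sharp : ~ rep3 2 sharp_graph.
Proof.
case=> x [y [z [D [uL szD eqxy eqxz]]]].
have ord_iota (i : 'I_8) : val i \in iota 0 8 by rewrite mem_iota ltn_ord.
have degE (i : sharp_graph) :
    deg i - count (edge i) D = sharp_deg [seq val j | j <- D] (val i).
  rewrite /sharp_deg count_map; congr (_ - _).
  by rewrite /deg cardsE cardE /enum_mem -enumT size_filter -(val_enum_ord 8) count_map.
have bad : sharp_bad [seq val j | j <- D].
  set E := map _ _; set d := sharp_deg E (val x).
  have sub t : t \in map val [:: x; y; z] -> [/\ t \in iota 0 8, t \notin E & sharp_deg E t = d].
    case/mapP => u uxyz ->; rewrite mem_iota ltn_ord; split=> //.
      rewrite mem_map; last exact: val_inj.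
      move: uL; rewrite -[[:: x, y, z & D]]/([:: x; y; z] ++ D) cat_uniq => /and3P[_ /hasPn nD _].
      by apply/negP => /nD /negP; apply.
    move: uxyz; rewrite /d !inE => /or3P[] /eqP ->; rewrite -!degE //.
  have [xE xnE _] := sub (val x) ltac:(by rewrite map_f // inE eqxx).
  apply/hasP; exists d; first by apply/mapP; exists (val x); rewrite // mem_filter xnE xE.
  (* [x], [y], [z] are distinct entries of the filtered list, so [d] occurs at least three times. *)
  rewrite count_map -size_filter; apply: (@uniq_leq_size _ (map val [:: x; y; z])).
    rewrite map_inj_uniq; last exact: val_inj.
    by move: uL; rewrite -[[:: x, y, z & D]]/([:: x; y; z] ++ D) cat_uniq => /and3P[].
  by move=> t /sub[tE tnE dt]; rewrite !mem_filter /= dt eqxx tnE tE.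
have uD : uniq D by case/and4P: uL.
case: D szD uD bad {uL eqxy eqxz degE} => [|u [|v [|//]]] _ uD /=.
- by rewrite (negbTE sharp_bad_nil).
- by rewrite (negbTE (allP sharp_bad1 _ (ord_iota u))).
- have /implyP := allP (allP sharp_bad2 _ (ord_iota u)) _ (ord_iota v).
  by move: uD; rewrite /= inE andbT val_eqE => uv /(_ uv) /negbTE ->.
Qed.

End Sharpness.

(** * The value of C(3) *)

Lemma admissible_3_3 : admissible 3 3%:Z.
Proof.
move=> G n0; have [n5|n4] := leqP 5 #|G|.
  have [D [leD [d le3]]] := rep3_set (rep3_3 n5).
  have leS := leq_trans le3 (deg_class_rep _ d).
  exists (~: D); split.
  - apply/eqP => S0; move: le3; rewrite leqNgt => /negP; apply.
    apply: (@leq_ltn_trans #|induced (~: D)|); first exact: max_card.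
    by rewrite card_induced S0 cards0.
  - by have := cardsC D; lia.
  - by apply: le_trans (_ : 3%:Z <= _)%R; rewrite ?ge_min ?lexx // lez_nat.
(* With at most four vertices the required repetition is at most 1, so nothing need be deleted. *)
exists [set: G]; split.
- by apply/set0Pn; case/card_gt0P: n0 => v _; exists v; rewrite inE.
- by rewrite cardsT; lia.
- apply: le_trans (_ : (#|G|%:Z - 3%:Z <= _)%R); first by rewrite ge_min lexx orbT.
  have : 0 < rep (induced [set: G]).
    by apply: rep_gt0; rewrite card_induced cardsT.
  by lia.
Qed.

Theorem theorem1p1 :
  (forall G : sgraph, 5 <= #|G| ->
     exists D : {set G},
       #|D| <= 3 /\
       exists d : nat, 3 <= #|deg_class (induced (~: D)) d|)
  /\ is_C 3 3%:Z.
Proof.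
split=> [G n5|]; first exact: rep3_set (rep3_3 n5).
split=> [|c adm]; first exact: admissible_3_3.
rewrite leNgt; apply/negP => c3.
have card8 : #|sharp_graph| = 8 by rewrite card_ord.
have [S [_ leS]] := adm sharp_graph (ltac:(by rewrite card8)).
(* From [c < 3] follows [8 - c >= 6]: the minimum is 3, and [S] omits at most two vertices. *)
rewrite card8 in leS *; rewrite min_l; last by lia.
rewrite lez_nat => /(rep_deg_class (ltn0Sn 2))[d le3].
apply: not_rep3_sharp; apply: rep3_of_set le3.
by have := cardsC S; rewrite card8; lia.
Qed.
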